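(* Let $d,k,l\ge1$ be integers and let $S\subset\mathbb R^d$ be a lattice simplex with $|I_l(S)|=k$. Then $$\mathrm{vol}(S)\le \frac{2^{3d-2}\cdot l^d\cdot(8l+7)^{(d-1)2^{d+1}}\cdot k}{d!}.$$ Equivalently, $s(d,k,l)\le 2^{3d-2} l^d (8l+7)^{(d-1)2^{d+1}}k/d!$.
   Context: A lattice simplex is a $d$-dimensional simplex whose vertices lie in $\mathbb Z^d$. $I_l(S)=\mathrm{int}(S)\cap l\mathbb Z^d$ is the set of interior points of $S$ whose coordinates are integers divisible by $l$. $s(d,k,l)$ denotes the maximum volume of a lattice simplex $S\subset\mathbb R^d$ with $|I_l(S)|=k$. *)

(* Defs.v *)
From HB Require Import structures.
From mathcomp Require Import all_boot all_order all_algebra.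
From mathcomp Require Import all_classical all_reals all_analysis.

Set Implicit Arguments.
Unset Strict Implicit.
Unset Printing Implicit Defensive.

Import Order.TTheory GRing.Theory Num.Theory.
Import numFieldNormedType.Exports.

Local Open Scope classical_set_scope.
Local Open Scope card_scope.
Local Open Scope ring_scope.

Section Simplices.
Context {R : realType} {d : nat}.

Definition affinely_independent n (v : 'I_n -> 'rV[R]_d) : Prop :=
  forall c : 'I_n -> R,
    \sum_i c i = 0 -> \sum_i c i *: v i = 0 -> forall i, c i = 0.

Definition convex_hull n (v : 'I_n -> 'rV[R]_d) : set 'rV[R]_d :=
  [set x | exists w : 'I_n -> R,
    [/\ forall i, 0 <= w i, \sum_i w i = 1 & x = \sum_i w i *: v i]].

(* The lattice l Z^d. *)
Definition lattice (l : nat) : set 'rV[R]_d :=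
  [set l%:R *: map_mx intr z | z in [set: 'rV[int]_d]].

Definition lattice_simplex (S : set 'rV[R]_d) : Prop :=
  exists v : 'I_d.+1 -> 'rV[R]_d,
    [/\ forall i, lattice 1 (v i), affinely_independent v & S = convex_hull v].

Definition interior_lattice_points (l : nat) (S : set 'rV[R]_d) :
    set 'rV[R]_d :=
  interior S `&` lattice l.

Definition box (a b : 'rV[R]_d) : set 'rV[R]_d :=
  [set x | forall i, a 0 i <= x 0 i <= b 0 i].

Definition box_volume (a b : 'rV[R]_d) : R :=
  \prod_i Num.max 0 (b 0 i - a 0 i).

(* d-dimensional Lebesgue measure, given on all sets by the outer measure
   obtained from countable coverings by boxes. *)
Definition vol (A : set 'rV[R]_d) : \bar R :=
  ereal_inf [set s | exists a b : nat -> 'rV[R]_d,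
    A `<=` \bigcup_n box (a n) (b n) /\
    s = (\sum_(0 <= n <oo) (box_volume (a n) (b n))%:E)%E].

End Simplices.

(* The maximum is rendered as a supremum in the extended reals, so that
   neither attainment nor nonemptiness of the family is presupposed. *)
Definition max_simplex_volume (R : realType) (d k l : nat) : \bar R :=
  ereal_sup [set vol S | S in
    [set S : set 'rV[R]_d |
      lattice_simplex S /\ interior_lattice_points l S #= `I_k]].

(* Main.v *)
Require Import Defs.
From mathcomp Require Import all_boot all_order all_fingroup all_algebra.
From mathcomp Require Import all_classical all_reals all_analysis.
From mathcomp Require Import zify ring lra.

(* Write an interior point w of l Z^d in barycentric coordinates a_0, ..., a_d
   with respect to the vertices v_i.  For integers q, p_i with sum p_i = q the
   point w + l (q w - sum p_i v_i) is again in l Z^d, with coordinates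
   a_i + l (q a_i - p_i).  If some a_i is tiny, Dirichlet's theorem applied to the
   large coordinates gives such q, p_i for which every new coordinate exceeds
   min a_i.  Hence the point of l Z^d in the interior that maximizes the least
   coordinate has all coordinates at least (8l+7)^(-2^(d+1)).

   Blichfeldt's principle applied to the box with sides a_i, for the d
   coordinates other than a_0, yields D a_1 ... a_d <= k l^d, where
   D = d! vol(S) is the determinant of the edge vectors.  Numbering the vertices
   so that a_0 is not the largest coordinate, one of the factors is
   at least 1 / (d + 1), which leaves d - 1 factors to be bounded as above. *)

Set Implicit Arguments.
Unset Strict Implicit.
Unset Printing Implicit Defensive.

Import Order.TTheory GRing.Theory Num.Theory.
Import numFieldNormedType.Exports.

Local Open Scope classical_set_scope.
Local Open Scope card_scope.
Local Open Scope ring_scope.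

(** * Simultaneous Diophantine approximation *)

Lemma card_dffun_ord n (M : 'I_n -> nat) :
  #|{dffun forall i, 'I_(M i)}| = (\prod_i M i)%N.
Proof.
rewrite card_dep_ffun foldrE big_map big_enum /=.
by apply: eq_bigr => i _; rewrite card_ord.
Qed.

(** Pigeonhole principle: the unit cube is cut into [M i] slices in direction i, and two of the N +
    1 points s x, s = 0, ..., N, taken modulo 1, share a cell. The difference of their multipliers
    is [q]. *)
Lemma simultaneous_dirichlet (R : archiRealFieldType) n (x : 'I_n -> R)
    (M : 'I_n -> nat) :
  (forall i, 0 < M i)%N ->
  exists2 q : nat, (0 < q <= \prod_i M i)%N &
    exists p : 'I_n -> int,
      forall i, `|q%:R * x i - (p i)%:~R| * (M i)%:R <= 1.
Proof.
move=> M0; set N := (\prod_i M i)%N.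
pose fl (s : nat) i : int := Num.floor (s%:R * x i).
pose r (s : nat) i : R := s%:R * x i - (fl s i)%:~R.
have r_itv s i : 0 <= r s i < 1.
  have /andP[h1 h2] := floor_itv (s%:R * x i).
  rewrite /r /fl; rewrite intrD in h2; lra.
(* The index of the slice in direction i that contains the fractional part [r s i]. *)
pose c (s : nat) i : nat := `|Num.floor (r s i * (M i)%:R)|%N.
have cE s i : ((c s i)%:R : R) <= r s i * (M i)%:R < (c s i)%:R + 1.
  have /andP[h1 h2] := floor_itv (r s i * (M i)%:R).
  have h0 : 0 <= Num.floor (r s i * (M i)%:R).
    by rewrite floor_ge0 mulr_ge0//; case/andP: (r_itv s i).
  have -> : ((c s i)%:R : R) = (Num.floor (r s i * (M i)%:R))%:~R.
    by rewrite -[LHS]/((c s i)%:~R) /c gez0_abs.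
  by rewrite intrD in h2; rewrite h1 h2.
have cM s i : (c s i < M i)%N.
  rewrite -(ltr_nat R); have /andP[h1 _] := cE s i.
  apply: le_lt_trans h1 _; case/andP: (r_itv s i) => _ h.
  by rewrite gtr_pMl// ltr0n M0.
pose f (s : 'I_N.+1) : {dffun forall i, 'I_(M i)} := [ffun i => Ordinal (cM s i)].
have /injectivePn[s [t]] : ~~ injectiveb f.
  by apply/negP => /injectiveP/leq_card; rewrite card_dffun_ord card_ord ltnn.
wlog st : s t / (s < t)%N.
  move=> h st e; case: (ltngtP s t) => [l|l|l].
  - exact: (h s t).
  - by apply: (h t s) => //; rewrite eq_sym.
  - by move/val_inj : l st => ->; rewrite eqxx.
move=> _ e; exists (t - s)%N.
  by rewrite subn_gt0 st/= (leq_trans (leq_subr _ _))// -ltnS ltn_ord.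
exists (fun i => fl t i - fl s i) => i.
have ec : c s i = c t i.
  by move/ffunP: e => /(_ i); rewrite !ffunE => -[].
have /andP[a1 a2] := cE s i; have /andP[b1 b2] := cE t i.
rewrite -ec in b1 b2.
have -> : (t - s)%:R * x i - (fl t i - fl s i)%:~R = r t i - r s i.
  by rewrite /r natrB ?(ltnW st)// intrB; ring.
rewrite -[X in _ * X](@ger0_norm _ (M i)%:R)// -normrM ler_norml; lra.
Qed.

(** * Improving a point that has a tiny coordinate *)

(* Chosen so that tail_bound_prod holds; the product there is the bound on the
   multiplier q given by Dirichlet's theorem in sorted_step. *)
Fixpoint tail_bound (l j : nat) : nat :=
  if j is j'.+1 then (32 * l * 16 ^ j' * tail_bound l j' ^ 2)%N else (8 * l)%N.

Lemma tail_bound_gt0 l j : (0 < l)%N -> (0 < tail_bound l j)%N.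
Proof.
by move=> l0; elim: j => [|j IH] /=; rewrite ?muln_gt0 ?expn_gt0 ?l0 ?IH.
Qed.

Lemma tail_bound_prod l j :
  tail_bound l j =
    (8 * l * 2 ^ j * \prod_(i < j) (4 * l * 4 ^ j * tail_bound l i))%N.
Proof.
have prodE k m : (\prod_(i < k) (4 * l * 4 ^ m * tail_bound l i) =
    (4 * l * 4 ^ m) ^ k * \prod_(i < k) tail_bound l i)%N.
  by rewrite big_split/= prod_nat_const card_ord.
elim: j => [|j IH] /=; first by rewrite big_ord0 expn0 !muln1.
rewrite {1}expnS expn1 {1}IH !prodE big_ord_recr/=.
set P := (\prod_(i < j) _)%N; set T := tail_bound l j.
(* Raising 4 ^ j to 4 ^ (j + 1) in each of the j old factors costs 4 ^ j in all; one further factor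
   is new. *)
have -> : ((4 * l * 4 ^ j.+1) ^ j.+1 = (4 * l * 4 ^ j) ^ j * (4 * l * 4 ^ j.+1) * 4 ^ j)%N.
  by rewrite expnS [in X in (_ * X)%N](expnSr 4) mulnA expnMn; ring.
have -> : (16 ^ j = 4 ^ j * 4 ^ j)%N by rewrite -expnMn.
rewrite !expnS; ring.
Qed.

Lemma tail_bound_le l j :
  (0 < l)%N -> (tail_bound l j <= (8 * l + 7) ^ (2 ^ (j + 2)))%N.
Proof.
move=> l0.
(* With this prefactor the left side is exactly squared when j grows by one, as is the right
   side. *)
have h : (32 * l * 16 ^ j.+1 * tail_bound l j <= (8 * l + 7) ^ (2 ^ (j + 2)))%N.
  elim: j => [|j IH] /=; first by rewrite /= !expnS expn0; nia.
  have -> : (2 ^ (j.+1 + 2) = 2 ^ (j + 2) * 2)%N by rewrite addSn expnS mulnC.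
  rewrite expnM; have := leq_mul IH IH; rewrite mulnn; apply: leq_trans; apply: eq_leq.
  by rewrite !expnS; ring.
apply: leq_trans h; rewrite leq_pmull// !muln_gt0 l0 expn_gt0//.
Qed.

(* Let j be the first index for which the tail a_(j+1) + ... + a_d is smaller
   than 1 / tail_bound l j.  By minimality of j the entries a_0, ..., a_j are not
   too small, and approximating a_1, ..., a_j simultaneously yields a q so small
   that the discrepancy absorbed by a_0 is harmless; the entries after j are
   multiplied by 1 + l q. *)
Lemma sorted_step (R : archiRealFieldType) (d l : nat) (a : nat -> R) :
  (0 < l)%N -> (0 < d)%N ->
  (forall i, (i <= d)%N -> 0 < a i) ->
  (forall i j, (i <= j <= d)%N -> a j <= a i) ->
  \sum_(i < d.+1) a i = 1 ->
  a d * (tail_bound l d.-1)%:R < 1 ->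
  exists2 q : nat, (0 < q)%N & exists2 p : nat -> int,
    \sum_(i < d.+1) p i = q%:Z &
    forall i, (i <= d)%N -> a d < a i + l%:R * (q%:R * a i - (p i)%:~R).
Proof.
move=> l0 d0 a0 a_sorted a1 ad.
pose tail j := \sum_(j.+1 <= i < d.+1) a i.
pose U j : R := (tail_bound l j)%:R.
have U0 j : 0 < U j by rewrite ltr0n tail_bound_gt0.
have : exists j, (j < d)%N && (tail j * U j < 1).
  by exists d.-1; rewrite prednK// leqnn /tail prednK// big_nat1.
case/ex_minnP => j /andP[jd tailj] jmin.
(* The power [y] dominates the number j + 1 of entries up to index j and keeps all later estimates
   monomial. *)
set E := tail j in tailj; set y : R := 2 ^+ j.
have jy : j%:R + 1 <= y.
  by rewrite /y -natrX natr1 ler_nat ltn_expl.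
have y1 : 1 <= y by rewrite (le_trans _ jy)// lerDr.
have l1 : 1 <= l%:R :> R by rewrite ler1n.
have block i : (i <= j)%N -> \sum_(i <= m < j.+1) a m <= y * a i.
  move=> ij; apply: (@le_trans _ _ (\sum_(i <= m < j.+1) a i)).
    apply: ler_sum_nat => m /andP[im mj]; apply: a_sorted; lia.
  rewrite sumr_const_nat -[leLHS]mulr_natl ler_wpM2r//.
    by apply/ltW/a0; lia.
  by apply: le_trans jy; rewrite natr1 ler_nat leq_subr.
have E0 : a d <= E.
  rewrite /E /tail big_nat_recr//= lerDr big_nat sumr_ge0// => m /andP[_ md].
  by apply/ltW/a0/ltnW.
have ad0 := a0 _ (leqnn d).
have Epos : 0 < E by apply: lt_le_trans E0.
pose M i := (4 * l * 4 ^ j * tail_bound l i)%N.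
have M0 (i : 'I_j) : (0 < M i)%N.
  by rewrite /M !muln_gt0 l0 expn_gt0 tail_bound_gt0.
set N := (\prod_(i < j) M i)%N.
have N0 : (0 < N)%N by rewrite prodn_gt0.
have MN (i : 'I_j) : (M i <= N)%N.
  by rewrite /N (bigD1 i)//= leq_pmulr// prodn_gt0.
have UE : U j = 8 * l%:R * y * N%:R.
  by rewrite /U tail_bound_prod -/N !natrM natrX.
have N1 : 1 <= N%:R :> R by rewrite ler1n.
have ME i : (M i)%:R = 4 * l%:R * y ^+ 2 * U i.
  by rewrite /M !natrM /y -exprM mulnC exprM -natrX -natrX.
have tail_split i : (i < j)%N -> tail i = \sum_(i.+1 <= m < j.+1) a m + E.
  by move=> ij; rewrite /tail (big_cat_nat (n := j.+1))//= ltnS ltnW.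
have E8 : E * (8 * l%:R * y * N%:R) < 1 by rewrite -UE.
have E8y : E * (8 * y) < 1.
  apply: le_lt_trans E8; rewrite ler_pM2l//.
  have -> : 8 * l%:R * y * N%:R = 8 * y * (l%:R * N%:R) by ring.
  by rewrite ler_peMr ?mulr_ege1// mulr_ge0// (le_trans _ y1).
have EU (i : 'I_j) : E * (32 * y * U i) < 1.
  apply: le_lt_trans E8; rewrite ler_pM2l//.
  apply: (@le_trans _ _ (8 * l%:R * y * (M i)%:R)); last first.
    by rewrite ler_wpM2l ?ler_nat// !mulr_ge0// (le_trans _ y1).
  rewrite ME.
  have -> : 8 * l%:R * y * (4 * l%:R * y ^+ 2 * U i) =
            (32 * y * U i) * (l%:R * l%:R * (y ^+ 2)) by ring.
  rewrite ler_peMr ?mulr_ege1// ?exprn_ege1// !mulr_ge0 ?(ltW (U0 _))//.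
  by rewrite (le_trans _ y1).
have total : a 0%N + \sum_(i < j) a i.+1 + E = 1.
  have -> : a 0%N + \sum_(i < j) a i.+1 = \sum_(i < j.+1) a i.
    by rewrite big_ord_recl.
  rewrite -a1 -!(big_mkord xpredT) /E /tail -big_cat_nat//=.
  by rewrite ltnS ltnW.
have head : 1 <= 2 * y * a 0%N.
  have := block _ (leq0n j); rewrite big_mkord big_ord_recl/=.
  rewrite /bump/= => h; nra.
(* By minimality of j the tail after i is at least 1 / U i. Its part up to j is at most y times its
   first entry, and the rest [E] is negligible. *)
have mid (i : 'I_j) : 1 <= 2 * U i * y * a i.+1.
  have := block i.+1 (ltn_ord i); have := tail_split _ (ltn_ord i).
  have : ~~ ((i < d)%N && (tail i * U i < 1)).
    by apply/negP => /jmin; rewrite leqNgt ltn_ord.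
  rewrite (ltn_trans (ltn_ord i) jd)/= -leNgt => h1 h2 h3.
  have h4 := EU i; rewrite h2 mulrDl in h1.
  have h5 := ler_wpM2r (ltW (U0 i)) h3.
  have h6 : E * U i * 1 <= E * U i * y by rewrite ler_pM2l// mulr_gt0.
  lra.
have [q /andP[q0 qN] [p' hp]] := simultaneous_dirichlet (fun i : 'I_j => a i.+1) M0.
(* The precision 1 / M i, compared with [mid], makes each error at most a 1 / (2 y l) fraction of
   its entry. *)
have small (i : 'I_j) : 2 * y * (l%:R * `|q%:R * a i.+1 - (p' i)%:~R|) <= a i.+1.
  have := hp i; rewrite ME; set D := `|_| => hD.
  have D0 : 0 <= D by rewrite normr_ge0.
  have ai : 0 < a i.+1 by apply/a0/(leq_trans (ltn_ord i)); rewrite ltnW.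
  apply: (@le_trans _ _ (2 * y * (l%:R * D) * (2 * U i * y * a i.+1))).
    by rewrite ler_peMr ?mid// !mulr_ge0// (le_trans _ y1).
  have -> : 2 * y * (l%:R * D) * (2 * U i * y * a i.+1) =
     (D * (4 * l%:R * y ^+ 2 * U i)) * a i.+1 by ring.
  by rewrite ler_piMl// ltW.
exists q => //.
pose pn m := if insub m is Some o then p' o else 0.
have pnE (i : 'I_j) : pn i = p' i by rewrite /pn valK.
have pn0 i : (j <= i)%N -> pn i = 0 by move=> ji; rewrite /pn insubF// ltnNge ji.
(* Entry 0 is forced by the sum condition; [p'] is shifted by one because it approximates a_1, ...,
   a_j, and the later entries get 0. *)
exists (fun m => if m is m'.+1 then pn m' else q%:Z - \sum_(i < j) p' i).
  rewrite big_ord_recl/= -[RHS]addr0 -addrA; congr (_ + _).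
  under eq_bigr do rewrite -pnE.
  rewrite -!(big_mkord xpredT) [X in _ + X](big_cat_nat (n := j))//= ?(ltnW jd)//.
  rewrite addKr big_nat big1// => i /andP[ji _]; exact: pn0.
case=> [_|i id].
  have dist : `|\sum_(i < j) (q%:R * a i.+1 - (p' i)%:~R)| * (2 * l%:R) <= a 0%N.
    have S : (2 * y * l%:R) * `|\sum_(i < j) (q%:R * a i.+1 - (p' i)%:~R)| <= y * a 0%N.
      apply: le_trans (_ : (2 * y * l%:R) * \sum_(i < j) `|q%:R * a i.+1 - (p' i)%:~R| <= _).
        by rewrite ler_wpM2l ?ler_norm_sum// !mulr_ge0// (le_trans _ y1).
      rewrite mulr_sumr; apply: le_trans (_ : \sum_(i < j) a 0%N <= _).
        apply: ler_sum => i _; rewrite -mulrA; apply: le_trans (small i) _.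
        by apply: a_sorted; rewrite /= (leq_trans (ltn_ord i)) ?(ltnW jd).
      rewrite sumr_const card_ord -[leLHS]mulr_natl; apply: ler_wpM2r; first exact/ltW/a0.
      by apply: le_trans jy; rewrite lerDl.
    rewrite -(@ler_pM2l _ y) ?(lt_le_trans _ y1)//; apply: le_trans S.
    by rewrite le_eqVlt; apply/orP; left; apply/eqP; ring.
  have -> : q%:R * a 0%N - (q%:Z - \sum_(i < j) p' i)%:~R =
            - (q%:R * E) - \sum_(i < j) (q%:R * a i.+1 - (p' i)%:~R).
    rewrite sumrB -mulr_sumr intrB rmorph_sum/=.
    have -> : q%:~R = q%:R * (a 0%N + \sum_(i < j) a i.+1 + E) :> R.
      by rewrite total mulr1.
    ring.
  set S := \sum_(i < j) _ in dist *.
  have {}dist := le_trans (ler_wpM2r _ (ler_norm S)) dist.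
  have {}dist : S * (2 * l%:R) <= a 0%N by apply: dist; rewrite mulr_ge0.
  have qNR : q%:R <= N%:R :> R by rewrite ler_nat.
  have : l%:R * (q%:R * E) <= l%:R * (N%:R * E).
    by rewrite ler_pM2l ?ltr0n// ler_pM2r.
  set z := l%:R * (N%:R * E) => hz.
  have : z * (8 * y) < 1 by move: E8; rewrite /z; congr (_ < _); ring.
  move: hz; set w := l%:R * (q%:R * E) => hz hy.
  have -> : l%:R * (- (q%:R * E) - S) = - w - S * l%:R by rewrite /w; ring.
  (* The errors cost at most half of a_0, the tail less than 1 / (8 y); as a_0 >= 1 / (2 y), at
     least 1 / (8 y) > E >= a_d remains. *)
  nra.
case: (ltnP i j) => [ij|ji].
  have := pnE (Ordinal ij) => /= ->.
  have := small (Ordinal ij); have := mid (Ordinal ij); have := EU (Ordinal ij).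
  have := U0 i => /=.
  have := ler_norm (- (q%:R * a i.+1 - (p' (Ordinal ij))%:~R)); rewrite normrN.
  set D := `|_|; set D' := _ - _; set u := U i => h1 h2 h3 h4 h5.
  have : l%:R * - D' <= l%:R * D by rewrite ler_pM2l ?ltr0n.
  have Dp : 0 <= l%:R * D by rewrite mulr_ge0 ?normr_ge0.
  move: h5 Dp; set x := l%:R * D; rewrite mulrN; set x' := l%:R * D' => h5 Dp h6.
  have h7 : 2 * x <= a i.+1 by nra.
  have : 0 < u * y by rewrite mulr_gt0// (lt_le_trans _ y1).
  have h8 : E * (32 * (u * y)) < 1 by move: h3; congr (_ < _); ring.
  have h9 : 1 <= 2 * (u * y) * a i.+1 by rewrite !mulrA.
  move: h8 h9; set v := u * y => h8 h9 v0.
  nra.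
rewrite pn0// subr0; apply: (@le_lt_trans _ _ (a i.+1)).
  by apply: a_sorted; rewrite id/=.
by rewrite ltrDl !mulr_gt0 ?ltr0n ?a0.
Qed.

(** Sorting the coordinates in decreasing order reduces this to [sorted_step]; [m] is the position
    of the smallest one. *)
Lemma coordinate_step (R : archiRealFieldType) (d l : nat)
    (a : 'I_d.+1 -> R) :
  (0 < l)%N -> (0 < d)%N -> (forall i, 0 < a i) -> \sum_i a i = 1 ->
  (exists i, a i * (tail_bound l d.-1)%:R < 1) ->
  exists2 q : nat, (0 < q)%N & exists2 p : 'I_d.+1 -> int,
    \sum_i p i = q%:Z &
    exists m, forall i, a m < a i + l%:R * (q%:R * a i - (p i)%:~R).
Proof.
move=> l0 d0 a0 a1 [k ak].
pose s := sort (fun i j => a j <= a i) (enum 'I_d.+1).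
have s_perm : perm_eq s (enum 'I_d.+1) by rewrite perm_sort.
have s_size : size s = d.+1 by rewrite (perm_size s_perm) size_enum_ord.
have s_uniq : uniq s by rewrite (perm_uniq s_perm) enum_uniq.
have s_mem i : i \in s by rewrite (perm_mem s_perm) mem_enum.
have s_sum (V : nmodType) (F : 'I_d.+1 -> V) :
    \sum_(i < d.+1) F (nth ord0 s i) = \sum_i F i.
  by rewrite -[RHS]big_enum -(perm_big _ s_perm)/= [RHS](big_nth ord0) s_size big_mkord.
have s_sorted i j : (i <= j <= d)%N -> a (nth ord0 s j) <= a (nth ord0 s i).
  move=> /andP[ij jd].
  have tr : transitive (fun i j : 'I_d.+1 => a j <= a i).
    by move=> x y z xy yz; apply: le_trans xy.
  apply: (sorted_leq_nth tr (fun i => lexx _)) => //.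
  - by apply: sort_sorted => x y; apply: le_total.
  - by rewrite inE s_size ltnS (leq_trans ij).
  - by rewrite inE s_size.
have idx i : (index i s <= d)%N.
  by have := s_mem i; rewrite -index_mem s_size.
have [||||q q0 [p sp hp]] := @sorted_step R d l (fun i => a (nth ord0 s i)) l0 d0.
- by move=> i _; apply: a0.
- exact: s_sorted.
- by rewrite s_sum.
- apply: le_lt_trans ak; rewrite ler_wpM2r//.
  by have := s_sorted (index k s) d; rewrite nth_index//; apply; rewrite idx leqnn.
exists q => //; exists (fun i => p (index i s)).
  rewrite -s_sum -sp; apply: eq_bigr => i _.
  by rewrite index_uniq// s_size.
exists (nth ord0 s d) => i.
by have := hp _ (idx i); rewrite nth_index.
Qed.

(** * Cosets of an integer sublattice *)

(** In the Smith form A = L D K, a representative of [y] is read off from the residues of the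
    entries of y K^-1 modulo the diagonal of D. As L and K are unimodular, there are |det A| residue
    vectors. *)
Lemma lattice_representatives n (A : 'M[int]_n) :
  \det A != 0 ->
  exists2 I : finType, #|I| = `|\det A|%N &
    exists r : I -> 'rV[int]_n, forall y, exists m i, y = m *m A + r i.
Proof.
move=> A0; have [L uL [K uK [s _ defA]]] := int_Smith_normal_form A.
pose D : 'rV[int]_n := \row_j s`_j.
have {}defA : A = L *m diag_mx D *m K.
  rewrite defA; congr (_ *m _ *m _); apply/matrixP => i j; rewrite !mxE.
  by rewrite val_eqE.
have absU (B : 'M[int]_n) : B \in unitmx -> `|\det B|%N = 1%N.
  by rewrite unitmxE => /orP[]/eqP->.
have detA : `|\det A|%N = (\prod_j `|D 0%R j|)%N.
  rewrite defA !det_mulmx !abszM (absU L)// (absU K)// mul1n muln1 det_diag.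
  by elim/big_ind2: _ => // x1 x2 y1 y2 <- <-; rewrite abszM.
have D0 j : (0 < `|D 0%R j|)%N.
  have : (0 < \prod_j `|D 0%R j|)%N by rewrite -detA absz_gt0.
  by rewrite (bigD1 j)//= muln_gt0 => /andP[].
exists {dffun forall j, 'I_`|D 0%R j|}; first by rewrite card_dffun_ord.
exists (fun c : {dffun forall j, 'I_`|D 0%R j|} => (\row_j (c j : nat)%:Z) *m K) => y.
pose z := y *m invmx K.
have r_lt j : (`|(z 0%R j %% D 0%R j)%Z| < `|D 0%R j|)%N.
  have D0' : D 0%R j != 0 by rewrite -absz_gt0.
  have := ltz_mod (z 0%R j) D0'; have := modz_ge0 (z 0%R j) D0'; lia.
exists ((\row_j (z 0%R j %/ D 0%R j)%Z) *m invmx L).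
exists [ffun j => Ordinal (r_lt j)].
rewrite defA !mulmxA mulmxKV// -mulmxDl -[LHS](mulmxKV uK) -/z.
congr (_ *m _); apply/rowP => j; rewrite mul_mx_diag !mxE ffunE /=.
rewrite gez0_abs ?modz_ge0 -?absz_gt0// [LHS](divz_eq _ (D 0%R j)).
by rewrite !mxE.
Qed.


(** * Barycentric coordinates of a simplex *)

Lemma continuous_bigsum (R : realType) (T : topologicalType) (I : Type)
    (r : seq I) (f : I -> T -> R) :
  (forall i, continuous (f i)) -> continuous (fun x => \sum_(i <- r) f i x).
Proof.
move=> fc; apply: (@continuous_big R I +%R 0 xpredT _ T r f) => // x.
exact: add_continuous.
Qed.

Section Barycentric.
Context {R : realType} {d : nat}.
Implicit Types (v : 'I_d.+1 -> 'rV[R]_d) (x : 'rV[R]_d).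

Definition edges v : 'M[R]_d := \matrix_j (v (lift ord0 j) - v ord0).

(* Barycentric coordinates of x; meaningful only if v is affinely independent,
   since invmx is the identity on singular matrices. *)
Definition bary v x (i : 'I_d.+1) : R :=
  let t := (x - v ord0) *m invmx (edges v) in
  if unlift ord0 i is Some j then t 0 j else 1 - \sum_j t 0 j.

Lemma bary_lift v x j :
  bary v x (lift ord0 j) = ((x - v ord0) *m invmx (edges v)) 0 j.
Proof. by rewrite /bary liftK. Qed.

Lemma combination_edges v (w : 'I_d.+1 -> R) :
  \sum_i w i *: v i =
    (\sum_i w i) *: v ord0 + (\row_j w (lift ord0 j)) *m edges v.
Proof.
rewrite !big_ord_recl mulmx_sum_row scalerDl -addrA; congr (_ + _).
rewrite scaler_suml -big_split; apply: eq_bigr => j _ /=.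
by rewrite mxE rowK scalerBr addrC subrK.
Qed.

(** A vector in the kernel, completed at [ord0] by minus the sum of its entries, is an affine
    dependence. *)
Lemma edges_unit v : affinely_independent v -> edges v \in unitmx.
Proof.
move=> vI; rewrite unitmxE unitfE; apply/negP => /det0P[c c0 cv].
pose w (i : 'I_d.+1) : R :=
  if unlift ord0 i is Some j then c 0 j else - \sum_j c 0 j.
have w0 : w ord0 = - \sum_j c 0 j by rewrite /w unlift_none.
have wl j : w (lift ord0 j) = c 0 j by rewrite /w liftK.
have w_sum : \sum_i w i = 0.
  by rewrite big_ord_recl w0 (eq_bigr _ (fun j _ => wl j)) addNr.
move/eqP: c0; apply; apply/rowP => j; rewrite mxE -wl; apply: vI => //.
rewrite combination_edges w_sum scale0r add0r -[RHS]cv; congr (_ *m _).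
by apply/rowP => k; rewrite mxE wl.
Qed.

Lemma sum_bary v x : \sum_i bary v x i = 1.
Proof.
rewrite big_ord_recl (eq_bigr _ (fun j _ => bary_lift v x j)).
by rewrite /bary unlift_none subrK.
Qed.

Lemma bary_combination v x :
  affinely_independent v -> \sum_i bary v x i *: v i = x.
Proof.
move=> vI; rewrite combination_edges sum_bary scale1r.
have -> : \row_j bary v x (lift ord0 j) = (x - v ord0) *m invmx (edges v).
  by apply/rowP => j; rewrite mxE bary_lift.
by rewrite mulmxKV ?edges_unit// addrC subrK.
Qed.

Lemma combination_bary v (w : 'I_d.+1 -> R) :
  affinely_independent v -> \sum_i w i = 1 ->
  forall i, bary v (\sum_i w i *: v i) i = w i.
Proof.
move=> vI w1.
have tE : (\sum_i w i *: v i - v ord0) *m invmx (edges v) = \row_j w (lift ord0 j).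
  by rewrite combination_edges w1 scale1r addrC addKr mulmxK ?edges_unit.
move=> i; rewrite /bary tE; case: unliftP => [j ->|->]; first by rewrite mxE.
by under eq_bigr do rewrite mxE; rewrite -w1 big_ord_recl addrK.
Qed.

Lemma convex_hullE v x : affinely_independent v ->
  convex_hull v x <-> forall i, 0 <= bary v x i.
Proof.
move=> vI; split=> [[w [w0 w1 ->]] i|h]; first by rewrite combination_bary.
by exists (bary v x); rewrite sum_bary bary_combination.
Qed.

Lemma continuous_bary v i : continuous (bary v ^~ i).
Proof.
have c j : continuous (fun x => ((x - v ord0) *m invmx (edges v)) 0 j).
  have -> : (fun x => ((x - v ord0) *m invmx (edges v)) 0 j) =
      (fun x => \sum_k (x 0 k - v ord0 0 k) * invmx (edges v) k j).
    by apply/funext => x; rewrite mxE; apply: eq_bigr => k _; rewrite !mxE.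
  apply: continuous_bigsum => k x.
  apply: (@continuousM R _ (fun x => x 0 k - v ord0 0 k)
    (fun=> invmx (edges v) k j)); last exact: cst_continuous.
  apply: (@continuousB R _ _ (fun x : 'rV[R]_d => x 0 k) (fun=> v ord0 0 k)).
    exact: coord_continuous.
  exact: cst_continuous.
pose t j x : R := ((x - v ord0) *m invmx (edges v)) 0 j.
have c0 : continuous (fun x : 'rV[R]_d => 1 - \sum_j t j x).
  move=> x; apply: (@continuousB R R^o _ (fun=> 1) (fun x => \sum_j t j x) x).
    exact: cst_continuous.
  exact: continuous_bigsum.
by rewrite /bary; case: unlift => [j|]; [exact: c|exact: c0].
Qed.

(** If coordinate i vanishes, a small move along v m - v i, for another vertex m, makes it negative
    and leaves the simplex. Conversely, positivity persists nearby by continuity. *)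
Lemma interior_convex_hull v x : (0 < d)%N -> affinely_independent v ->
  interior (convex_hull v) x <-> forall i, 0 < bary v x i.
Proof.
move=> d0 vI; split=> [xS i|h].
  have /convex_hullE-/(_ vI i) := interior_subset xS.
  rewrite le_eqVlt => /orP[/eqP bi|//].
  have [m mi] : exists m, m != i.
    exists (lift i (Ordinal d0)); by rewrite eq_sym neq_lift.
  have : (fun t : R => x + t *: (v m - v i)) @ (0 : R) --> x.
    rewrite -[X in _ --> X]addr0 -(scale0r (v m - v i)).
    apply: cvgD; first exact: cvg_cst.
    by apply: cvgZ; [exact: cvg_id|exact: cvg_cst].
  move/(_ _ xS) => /nbhs_ballP[e /= e0 /(_ (e / 2))].
  have e2 : 0 < e / 2 by rewrite divr_gt0.
  have e_ball : ball 0 e (e / 2).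
    by rewrite -ball_normE /= sub0r normrN gtr0_norm// ltr_pdivrMr// ltr_pMr// ltr1n.
  move=> /(_ e_ball)/convex_hullE-/(_ vI i).
  pose w k := bary v x k + e / 2 * ((k == m)%:R - (k == i)%:R).
  have delta (k : 'I_d.+1) : \sum_j (j == k)%:R = 1 :> R.
    by rewrite (bigD1 k)//= eqxx big1 ?addr0// => j /negbTE->.
  have deltav (k : 'I_d.+1) : \sum_j (j == k)%:R *: v j = v k.
    rewrite (bigD1 k)//= eqxx scale1r big1 ?addr0// => j /negbTE->.
    by rewrite scale0r.
  have -> : x + (e / 2) *: (v m - v i) = \sum_k w k *: v k.
    rewrite -{1}(bary_combination x vI) -deltav -(deltav i) -sumrB scaler_sumr.
    rewrite -big_split; apply: eq_bigr => k _ /=.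
    by rewrite /w -scalerBl scalerA -scalerDl.
  rewrite combination_bary// /w; last first.
    by rewrite big_split/= sum_bary -mulr_sumr sumrB !delta subrr mulr0 addr0.
  by rewrite -bi add0r eqxx eq_sym (negbTE mi) sub0r mulrN1 oppr_ge0 leNgt e2.
have /filter_forall : forall i, \forall y \near nbhs x, 0 < bary v y i.
  by move=> i; exact: (@continuous_bary v i x) _ (lt_nbhsr (h i)).
rewrite /interior/=; apply: filterS => y yb.
by apply/convex_hullE => // i; apply/ltW.
Qed.

End Barycentric.

(** * Lattice points in the interior of a simplex *)

Lemma finite_set_argmax (T : eqType) (R : realDomainType) (A : set T)
    (f : T -> R) :
  finite_set A -> (exists x, A x) -> exists2 x, A x & forall y, A y -> f y <= f x.
Proof.
move=> /finite_seqP[s ->] [x0 /= x0s].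
elim: s x0 x0s => [//|y s IH] x0 _.
case: s IH => [_|z s IH].
  by exists y => [|x] /=; rewrite inE// => /eqP->.
have [x xs hx] := IH z (mem_head _ _).
have [yx|xy] := leP (f y) (f x).
  exists x => [|w] /=; rewrite inE; first by rewrite [X in _ || X]xs orbT.
  by move=> /orP[/eqP->//|/hx].
exists y => [|w] /=; rewrite inE ?eqxx//.
by move=> /orP[/eqP->//|/hx h]; apply: le_trans h (ltW xy).
Qed.

Section LatticeSimplex.
Context {R : realType} {d : nat} (l : nat) (z : 'I_d.+1 -> 'rV[int]_d).
Hypotheses (d_gt0 : (0 < d)%N) (l_gt0 : (0 < l)%N).

Let v (i : 'I_d.+1) : 'rV[R]_d := map_mx intr (z i).

Hypothesis vI : affinely_independent v.

Let I : set 'rV[R]_d := interior_lattice_points l (convex_hull v).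

Lemma mem_interior_lattice_points x :
  I x <-> (forall i, 0 < bary v x i) /\ lattice l x.
Proof. by rewrite /I /interior_lattice_points/= -interior_convex_hull. Qed.

Lemma deep_interior_point : finite_set I -> (exists x, I x) ->
  exists2 x, I x & forall i, 1 <= bary v x i * (tail_bound l d.-1)%:R.
Proof.
move=> I_fin I0.
(* The default value of the minimum is itself a coordinate, so [depth x] is the least coordinate. *)
pose depth x := \big[Num.min/bary v x ord0]_i bary v x i.
have [x Ix x_max] := finite_set_argmax depth I_fin I0.
exists x => // i; rewrite leNgt; apply/negP => xi.
have /mem_interior_lattice_points[x0 [u _ ux]] := Ix.
have [|q q0 [p p_sum [m hm]]] :=
  coordinate_step l_gt0 d_gt0 x0 (sum_bary v x); first by exists i.
pose w j : R := bary v x j + l%:R * (q%:R * bary v x j - (p j)%:~R).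
pose y := \sum_j w j *: v j.
have w_sum : \sum_j w j = 1.
  rewrite /w big_split/= sum_bary -mulr_sumr sumrB -mulr_sumr sum_bary mulr1.
  by rewrite -rmorph_sum p_sum/= subrr mulr0 addr0.
have bw j : bary v y j = w j by rewrite /y combination_bary.
(* This form shows that [y] stays in l Z^d: the bracket is an integer vector. *)
have yE : y = x + l%:R *: (q%:R *: x - \sum_j (p j)%:~R *: v j).
  rewrite -{1 2}(bary_combination x vI) /y scaler_sumr -sumrB scaler_sumr.
  rewrite -big_split; apply: eq_bigr => j _ /=.
  by rewrite /w scalerDl -scalerA scalerBl scalerA.
have Iy : I y.
  apply/mem_interior_lattice_points; split.
    by move=> j; rewrite bw; apply: lt_trans (hm j).
  exists (u + (l%:Z *: (q%:Z *: u) - \sum_j p j *: z j)) => //.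
  rewrite yE -ux; apply/rowP => j; rewrite !mxE !summxE.
  have -> : \sum_i ((p i)%:~R *: v i) 0 j = (\sum_i (p i *: z i) 0 j)%:~R :> R.
    by rewrite rmorph_sum; apply: eq_bigr => i' _; rewrite !mxE rmorphM.
  by rewrite !(rmorphD, rmorphN, rmorphM)/=; ring.
have := x_max _ Iy; apply/negP; rewrite -ltNge.
have lt_depth j : depth x < bary v y j.
  rewrite bw; apply: le_lt_trans (hm j); exact: bigmin_le.
exact: lt_bigmin.
Qed.

Let V : 'M[int]_d := \matrix_j (z (lift ord0 j) - z ord0).

Lemma edges_int : edges v = map_mx intr V.
Proof. by apply/matrixP => i j; rewrite !mxE rmorphB. Qed.

Lemma det_int_neq0 : \det V != 0.
Proof.
have := edges_unit vI; rewrite edges_int unitmxE det_map_mx unitfE.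
by rewrite intr_eq0.
Qed.

(* Blichfeldt's argument, made finite by working with the points of the lattice
   (1/D) * (span of the edges), which contains Z^d.  All members of a class modulo l Z^d
   are compared with the one whose coordinate at v ord0 is smallest, so
   that this coordinate only increases and needs no factor in the product. *)
Lemma prod_bary_le k x : I #= `I_k -> I x ->
  `|\det V|%N%:R * \prod_j bary v x (lift ord0 j) <= k%:R * l%:R ^+ d.
Proof.
move=> Ik Ix; have /mem_interior_lattice_points[x0 [u _ ux]] := Ix.
set D := `|\det V|%N.
have D0 : 0 < D%:R :> R by rewrite ltr0n absz_gt0 det_int_neq0.
(* By Cramer's rule the coordinates of [x] away from [v ord0] are the entries of [U] over det V;
   being positive, they equal [a j] / D. *)
pose U := (l%:Z *: u - z ord0) *m \adj V.
have detE : `|(\det V)%:~R| = D%:R :> R by rewrite -intr_norm -abszE.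
pose a j := `|U 0%R j|%N.
have aE j : (a j)%:R = bary v x (lift ord0 j) * D%:R.
  rewrite -detE -[bary _ _ _]gtr0_norm// -normrM bary_lift.
  have -> : ((x - v ord0) *m invmx (edges v)) 0 j * (\det V)%:~R =
      (((x - v ord0) *m invmx (edges v)) *m (\det V)%:~R%:M) 0 j.
    by rewrite mul_mx_scalar [RHS]mxE mulrC.
  rewrite -det_map_mx -mul_mx_adj -edges_int mulmxA mulmxKV ?edges_unit//.
  rewrite edges_int -map_mx_adj.
  have -> : x - v ord0 = map_mx intr (l%:Z *: u - z ord0).
    by apply/rowP => i; rewrite -ux !mxE rmorphB rmorphM.
  by rewrite -map_mxM mxE -intr_norm -abszE.
(* t lies in the row lattice of A only if (t / D) V lies in l Z^d *)
pose A := l%:Z *: \adj V.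
have AV : A *m V = (l%:Z * \det V)%:M.
  by rewrite -scalemxAl mul_adj_mx scale_scalar_mx.
have detA : (`|\det A| * D = l ^ d * D ^ d)%N.
  by rewrite -abszM -det_mulmx AV det_scalar abszX abszM expnMn.
have A0 : \det A != 0.
  rewrite -absz_eq0 -(eqn_pmul2r (m := D)) ?absz_gt0 ?det_int_neq0//.
  by rewrite detA mul0n -lt0n muln_gt0 !expn_gt0 l_gt0 absz_gt0 det_int_neq0.
have [C cardC [r hr]] := lattice_representatives A0.
pose T : finType := {dffun forall j, 'I_(a j)}.
pose vec (t : T) : 'rV[int]_d := \row_j (t j : nat)%:Z.
have /boolp.choice[c hc] : forall t : T, exists i : C, exists m, vec t = m *m A + r i.
  by move=> t; have [m [i e]] := hr (vec t); exists i, m.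
(* If every class has at most k members, then |T| <= k |C|, which is the claim because |T| is D ^ d
   times the product of coordinates and |C| D = l ^ d D ^ d. A larger class would give more than k
   points of [I]. *)
have [big|small] := boolP [exists i, k < #|[set t | c t == i]%SET|]%N; last first.
  have cardT : (#|T| <= k * #|C|)%N.
    rewrite -sum1_card (partition_big c xpredT)//= mulnC -sum_nat_const.
    apply: leq_sum => i _; rewrite sum1_card leqNgt; apply: contra small => h.
    by apply/existsP; exists i; rewrite cardsE.
  rewrite -(@ler_pM2r _ (D%:R ^+ d)) ?exprn_gt0// -!natrX.
  have -> : k%:R * (l ^ d)%:R * (D ^ d)%:R = (k * #|C|)%:R * D%:R :> R.
    by rewrite cardC -!natrM -!mulnA detA.
  rewrite [leLHS](_ : _ = #|T|%:R * D%:R); first by rewrite ler_pM2r// ler_nat.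
  rewrite card_dffun_ord natr_prod (eq_bigr _ (fun j _ => aE j)) big_split/=.
  by rewrite prodr_const card_ord natrX; ring.
have /existsP[i0 hi0] := big.
set F := [set t | c t == i0]%SET in hi0.
have /card_gt0P[t0 t0F] : (0 < #|F|)%N by apply: leq_ltn_trans hi0.
(* The largest sum of the other coordinates means the smallest coordinate at [v ord0]. *)
case: (arg_maxnP (fun t : T => \sum_j t j)%N t0F) => tm tmF tm_max.
have cF t : t \in F -> c t = i0 by rewrite inE => /eqP.
pose del (t : T) j : R := ((t j)%:R - (tm j)%:R) / D%:R.
(* The coordinates of [x] translated by (t - tm) / D along the edges; the entry at [ord0] restores
   the sum 1. *)
pose w t i : R := bary v x i +
  if unlift ord0 i is Some j then del t j else - \sum_j del t j.
have wl t j : w t (lift ord0 j) = bary v x (lift ord0 j) + del t j.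
  by rewrite /w liftK.
have w1 t : \sum_i w t i = 1.
  rewrite big_split/= sum_bary big_ord_recl unlift_none.
  by under [X in _ + (_ + X)]eq_bigr do rewrite liftK; rewrite addNr addr0.
pose g t := \sum_i w t i *: v i.
have bg t i : bary v (g t) i = w t i by rewrite combination_bary.
have gI t : t \in F -> I (g t).
  move=> tF; apply/mem_interior_lattice_points; split => [i|].
    rewrite bg; case: (unliftP ord0 i) => [j ->|->].
      rewrite wl /del.
      have -> : bary v x (lift ord0 j) = (a j)%:R / D%:R.
        by rewrite aE mulfK// lt0r_neq0.
      (* Positive because tm j < a j. *)
      rewrite -mulrDl divr_gt0// addrCA ltr_wpDl// subr_gt0 ltr_nat.
      exact: ltn_ord.
    rewrite /w unlift_none ltr_wpDr// oppr_ge0 /del -mulr_suml.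
    rewrite mulr_le0_ge0 ?invr_ge0 ?(ltW D0)// sumrB subr_le0 -!natr_sum ler_nat.
    exact: tm_max.
  have [m em] := hc t; have [m' em'] := hc tm.
  have ct : c t = c tm by rewrite !cF.
  (* Within a class t - tm = (m - m') A, and A V / D is l times the sign of det V. *)
  exists (u + sgz (\det V) *: (m - m')) => //.
  rewrite /g combination_edges w1 scale1r.
  have -> : \row_j w t (lift ord0 j) =
     (x - v ord0) *m invmx (edges v) + D%:R^-1 *: map_mx intr (vec t - vec tm).
    by apply/rowP => j; rewrite !mxE wl bary_lift mxE /del rmorphB/= mulrC.
  rewrite mulmxDl mulmxKV ?edges_unit// addrA (addrC (v ord0)) subrK -ux.
  rewrite em em' ct opprD addrACA subrr addr0 -mulmxBl -scalemxAl edges_int.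
  rewrite -map_mxM -mulmxA AV mul_mx_scalar.
  have sgE : (\det V)%:~R = (sgz (\det V))%:~R * D%:R :> R.
    by rewrite {1}(intEsg (\det V)) rmorphM.
  apply/rowP => j; rewrite !mxE !(rmorphD, rmorphM, rmorphN)/= sgE.
  have D1 : D%:R != 0 :> R by rewrite lt0r_neq0.
  by field.
have gF : {in F &, injective g}.
  move=> t t' _ _ e; apply/ffunP => j; apply/val_inj/eqP => /=.
  have : w t (lift ord0 j) = w t' (lift ord0 j) by rewrite -!bg e.
  rewrite !wl => /addrI; rewrite /del => /(mulIf _) h.
  by rewrite -(eqr_nat R); apply/eqP/(addIr (- (tm j)%:R))/h; rewrite invr_eq0 lt0r_neq0.
have /card_set_bijP[f [f_fun f_inj _]] := Ik.
have : (#|F| <= k)%N.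
  rewrite cardE -(size_map (f \o g)) -[leqRHS](size_iota 0); apply: uniq_leq_size.
    rewrite map_inj_in_uniq ?enum_uniq// => t t'; rewrite !mem_enum => tF t'F.
    by move=> /= /f_inj e; apply: gF => //; apply: e; rewrite inE; apply: gI.
  move=> n /mapP[t]; rewrite mem_enum => tF ->; rewrite mem_iota add0n /=.
  exact: (f_fun _ (gI _ tF)).
by rewrite leqNgt hi0.
Qed.

End LatticeSimplex.

(** * Covering a simplex by grid cubes *)

Lemma vol_le_boxes (R : realType) (d : nat) (A : set 'rV[R]_d)
    (s : seq ('rV[R]_d * 'rV[R]_d)) :
  (0 < d)%N ->
  (forall x, A x -> exists2 p, p \in s & box p.1 p.2 x) ->
  (vol A <= (\sum_(p <- s) box_volume p.1 p.2)%:E)%E.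
Proof.
(* Past the end of [s] the default is the one-point box at the origin, of volume 0 since d > 0. *)
move=> d0 As; pose p n := nth (0, 0) s n.
apply: ereal_inf_lbound; exists (fun n => (p n).1), (fun n => (p n).2); split.
  move=> x /As[q qs qx]; exists (index q s) => //.
  by rewrite /p nth_index.
have vol0 (q : 'rV[R]_d * 'rV[R]_d) : (0 <= (box_volume q.1 q.2)%:E)%E.
  by rewrite lee_fin prodr_ge0// => i _; rewrite le_max lexx.
rewrite (nneseries_split _ (size s)); last by move=> n _; exact: vol0.
rewrite add0n eseries0 ?adde0; last first.
  move=> n sn _; rewrite /p nth_default//= /box_volume.
  by rewrite (bigD1 (Ordinal d0))//= !mxE subrr maxxx mul0r.
by rewrite sumEFin (big_nth (0, 0)).
Qed.

Lemma bin_fact_le n m : ('C(n, m) * m`! <= n ^ m)%N.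
Proof.
rewrite bin_ffact; elim: m n => [|m IH] n; first by rewrite ffactn0.
rewrite ffactnS expnS leq_mul2l; apply/orP; right.
by apply: leq_trans (IH _) _; case: m {IH} => // m; rewrite leq_exp2r// leq_pred.
Qed.

Section SimplexVolume.
Context {R : realType} {d : nat} (z : 'I_d.+1 -> 'rV[int]_d).
Hypothesis d_gt0 : (0 < d)%N.

Let v (i : 'I_d.+1) : 'rV[R]_d := map_mx intr (z i).

Hypothesis vI : affinely_independent v.

Let V : 'M[int]_d := \matrix_j (z (lift ord0 j) - z ord0).

(* Cover by the cubes of the grid (1/n) Z^d that meet the simplex: their corners
   form |det V| cosets of the edge lattice, and in each of them the edge
   coordinates range over nonnegative integers of sum at most n + K, up to
   a translation. *)
Lemma vol_simplex_le_bin : exists K : nat, forall n, (0 < n)%N ->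
  (vol (convex_hull v) <=
    ((`|\det V| * 'C(d + (n + K), d))%N%:R / n%:R ^+ d)%:E)%E.
Proof.
have [C cardC [r hr]] := lattice_representatives (det_int_neq0 vI).
rewrite -/V in cardC hr.
pose E := invmx (edges v).
(* A bound, uniform over the representatives, for the edge coordinates of r c plus any offset in the
   unit cube. *)
pose B : R := \sum_c \sum_i \sum_j (1 + `|(r c 0 i)%:~R|) * `|E i j|.
pose M := (Num.trunc B).+1.
have BM : B <= M%:R.
  apply/ltW; apply: truncnS_gt.
have err (rho : 'rV[R]_d) c j : (forall i, 0 <= rho 0 i < 1) ->
    `|((rho + map_mx intr (r c)) *m E) 0 j| <= M%:R.
  move=> rho01; apply: le_trans BM; rewrite mxE.
  have t0 c' i' j' : 0 <= (1 + `|(r c' 0 i')%:~R|) * `|E i' j'|.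
    by rewrite mulr_ge0// addr_ge0.
  apply: le_trans (ler_norm_sum _ _ _) _; rewrite /B (bigD1 c)//= ler_wpDr//.
    by do 3 (apply: sumr_ge0 => ? _).
  apply: ler_sum => i _; rewrite (bigD1 j)//= ler_wpDr//.
    by apply: sumr_ge0 => ? _.
  rewrite normrM ler_wpM2r// !mxE; apply: le_trans (ler_normD _ _) _.
  have /andP[a1 a2] := rho01 i.
  by rewrite lerD2r ger0_norm// ltW.
(* Each of the d coordinates is raised by M to become nonnegative, and its rounding error is at most
   another M. *)
exists (2 * d * M)%N => n n0.
set N := (n + 2 * d * M)%N.
have nR : 0 < n%:R :> R by rewrite ltr0n.
pose J := finset.setX [set: C]%SET
  [set t : d.-tuple 'I_N.+1 | (\sum_(i <- t) i <= N)%N]%SET.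
pose low (p : C * d.-tuple 'I_N.+1) : 'rV[R]_d := n%:R^-1 *:
  map_mx intr (n%:Z *: z ord0 + ((\row_j ((tnth p.2 j : nat)%:Z - M%:Z)) *m V + r p.1)).
pose s := [seq (low p, low p + const_mx n%:R^-1) | p <- enum J].
have -> : (`|\det V| * 'C(d + N, d))%N%:R / n%:R ^+ d =
    \sum_(p <- s) box_volume p.1 p.2 :> R.
  rewrite big_map big_enum/= (eq_bigr (fun=> (n%:R ^+ d)^-1)) => [|p _].
    rewrite sumr_const cardsX cardsT card_partial_ord_partitions cardC.
    by rewrite -[RHS]mulr_natl.
  rewrite /box_volume (eq_bigr (fun=> n%:R^-1)) => [|j _].
    by rewrite prodr_const card_ord exprVn.
  move: (low p) => /= q.
  by rewrite !mxE (addrC (q 0 j)) addrK max_r// invr_ge0 ltW.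
apply: vol_le_boxes => // x /convex_hullE-/(_ vI) x0.
pose y : 'rV[int]_d := \row_i Num.floor (n%:R * x 0 i).
pose rho : 'rV[R]_d := n%:R *: x - map_mx intr y.
have rho01 i : 0 <= rho 0 i < 1.
  rewrite !mxE; have /andP[h1 h2] := floor_itv (n%:R * x 0 i).
  by rewrite intrD in h2; lra.
(* The edge part [m] of the rounded point differs from n times the edge coordinates of [x] only by
   the bounded error [e]. *)
have [m [c ym]] := hr (y - n%:Z *: z ord0).
pose e : 'rV[R]_d := (rho + map_mx intr (r c)) *m E.
have eM j : `|e 0 j| <= M%:R := err rho c j rho01.
have mE j : (m 0 j)%:~R = n%:R * bary v x (lift ord0 j) - e 0 j.
  have -> : n%:R * bary v x (lift ord0 j) - e 0 j =
    (n%:R *: ((x - v ord0) *m E) - e) 0 j by rewrite !mxE bary_lift mxE.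
  rewrite /e scalemxAl -mulmxBl.
  have -> : n%:R *: (x - v ord0) - (rho + map_mx intr (r c)) =
      map_mx intr m *m edges v.
    rewrite edges_int -map_mxM.
    have -> : m *m V = y - n%:Z *: z ord0 - r c by rewrite ym addrK.
    by apply/rowP => i; rewrite !mxE !(rmorphD, rmorphN, rmorphM)/=; ring.
  by rewrite mulmxK ?edges_unit// mxE.
have m_ge j : - M%:Z <= m 0 j.
  rewrite -(ler_int R) mE rmorphN/=.
  have := eM j; rewrite ler_norml => /andP[_ h].
  have : 0 <= n%:R * bary v x (lift ord0 j) by rewrite mulr_ge0// ltW.
  by rewrite -[M%:~R]/(M%:R); lra.
have m_sum : \sum_j (m 0 j + M%:Z) <= N%:Z.
  rewrite -(ler_int R) rmorph_sum/=.
  have -> : \sum_j (m 0 j + M%:Z)%:~R =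
      n%:R * (1 - bary v x ord0) + \sum_j (M%:R - e 0 j).
    have -> : 1 - bary v x ord0 = \sum_j bary v x (lift ord0 j).
      by rewrite -(sum_bary v x) big_ord_recl addrC addKr.
    rewrite mulr_sumr -big_split.
    by apply: eq_bigr => j _; rewrite rmorphD/= mE -[M%:~R]/(M%:R); ring.
  have : \sum_(j < d) (M%:R - e 0 j) <= \sum_(j < d) (2 * M%:R).
    by apply: ler_sum => j _; have := eM j; rewrite ler_norml => /andP[h _]; lra.
  rewrite sumr_const card_ord -mulr_natl.
  have : n%:R * (1 - bary v x ord0) <= n%:R.
    by rewrite ler_piMr ?(ltW nR)// gerBl.
  by rewrite -[N%:~R]/(N%:R) /N natrD !natrM; lra.
have tau_lt j : (`|(m 0%R j + M%:Z)%R| < N.+1)%N.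
  have h : \sum_(i | i != j) (m 0 i + M%:Z) >= 0.
    by apply: sumr_ge0 => i _; have := m_ge i; lia.
  have aux (a b : int) (p q : nat) :
    0 <= a -> b + q%:Z + a <= p%:Z -> - q%:Z <= b -> (`|(b + q%:Z)%R| < p.+1)%N by lia.
  by apply: aux h _ (m_ge j); move: m_sum; rewrite (bigD1 j).
pose tau : d.-tuple 'I_N.+1 := [tuple Ordinal (tau_lt j) | j < d].
have tauE j : (tnth tau j : nat)%:Z = m 0 j + M%:Z.
  by rewrite tnth_mktuple/= gez0_abs// -[M%:Z]opprK subr_ge0.
have tau_sum : (\sum_(j < d) tnth tau j)%N%:Z = \sum_j (m 0 j + M%:Z).
  by rewrite -natz natr_sum; apply: eq_bigr => j _; rewrite natz tauE.
have tau_N : (\sum_(i <- tau) i <= N)%N by rewrite big_tuple -lez_nat tau_sum.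
exists (low (c, tau), low (c, tau) + const_mx n%:R^-1).
  by apply: map_f; rewrite mem_enum !inE/=; exact: tau_N.
have lowE : low (c, tau) = n%:R^-1 *: map_mx intr y.
  rewrite /low/=.
  have -> : \row_j ((tnth tau j : nat)%:Z - M%:Z) = m.
    by apply/rowP => j; rewrite mxE tauE addrK.
  by rewrite -ym addrC subrK.
move=> i; rewrite /= lowE !mxE.
have /andP[h1 h2] := floor_itv (n%:R * x 0 i); rewrite intrD in h2.
rewrite ler_pdivrMl// h1/= -[X in _ + X]mulr1 -mulrDr ler_pdivlMl//.
exact: ltW.
Qed.

(** The binomial coefficient is at most (d + n + K) ^ d / d!, and its quotient by n ^ d tends to 1 /
    d! when the grid is refined. *)
Lemma vol_simplex_le :
  (vol (convex_hull v) <= (`|\det V|%N%:R / d`!%:R)%:E)%E.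
Proof.
have [K hK] := vol_simplex_le_bin.
pose c : R := `|\det V|%N%:R / d`!%:R.
pose u n : R := c * (1 + (d + K)%:R * harmonic n) ^+ d.
have vol_u n : (vol (convex_hull v) <= (u n)%:E)%E.
  apply: le_trans (hK _ (ltn0Sn n)) _; rewrite lee_fin /u /c.
  have f0 : 0 < d`!%:R :> R by rewrite ltr0n fact_gt0.
  have n0 : 0 < n.+1%:R :> R by rewrite ltr0n.
  have -> : 1 + (d + K)%:R * harmonic n = (d + (n.+1 + K))%:R / n.+1%:R :> R.
    by rewrite /harmonic/= !natrD; field; rewrite lt0r_neq0.
  rewrite expr_div_n mulrA ler_pM2r ?invr_gt0 ?exprn_gt0//.
  rewrite natrM mulrAC -mulrA; apply: ler_wpM2l => //.
  rewrite ler_pdivlMr// -natrX -natrM ler_nat; exact: bin_fact_le.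
have u_cvg : u @ \oo --> c.
  rewrite -[X in _ --> X]mulr1 -(expr1n _ d) -[X in X ^+ d]addr0 -(mulr0 (d + K)%:R).
  apply: cvgM; first exact: cvg_cst.
  apply: (@cvg_comp _ _ _ _ (fun x : R => x ^+ d) _ _ _ _ (@exprn_continuous R d _)).
  apply: cvgD; first exact: cvg_cst.
  by apply: cvgM; [exact: cvg_cst|exact: cvg_harmonic].
apply/lee_addgt0Pr => e e0.
move/cvgrPdist_lt : u_cvg => /(_ _ e0)[n _ /(_ n (leqnn n))/=] h.
apply: le_trans (vol_u n) _; rewrite -EFinD lee_fin -/c.
by move: h; rewrite ltr_norml; lra.
Qed.

End SimplexVolume.

(** * Renumbering the vertices and the final estimate *)

Lemma affinely_independent_perm (R : realType) d n (v : 'I_n -> 'rV[R]_d)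
    (s : {perm 'I_n}) :
  affinely_independent v -> affinely_independent (v \o s).
Proof.
move=> vI c c0 cv i; rewrite -[i](permK s).
apply: (vI (fun j => c (s^-1%g j))); rewrite (reindex_inj (@perm_inj _ s)).
  by rewrite -[RHS]c0; apply: eq_bigr => j _; rewrite permK.
by rewrite -[RHS]cv; apply: eq_bigr => j _; rewrite permK.
Qed.

Lemma convex_hull_perm (R : realType) d n (v : 'I_n -> 'rV[R]_d) (s : {perm 'I_n}) :
  convex_hull (v \o s) = convex_hull v.
Proof.
apply/seteqP; split=> x [w [w0 w1 ->]].
  exists (w \o s^-1%g); split=> [i||]; first exact: w0.
    by rewrite -w1 [RHS](reindex_inj (@perm_inj _ s^-1%g)).
  rewrite [LHS](reindex_inj (@perm_inj _ s^-1%g)).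
  by apply: eq_bigr => i _ /=; rewrite permKV.
exists (w \o s); split=> [i||]; first exact: w0.
  by rewrite -w1 [RHS](reindex_inj (@perm_inj _ s)).
by rewrite [LHS](reindex_inj (@perm_inj _ s)).
Qed.

(** The case to which a renumbering reduces the theorem: the largest coordinate is among the factors
    in [prod_bary_le]. *)
Lemma vol_simplex_le_of_argmax (R : realType) (d l k : nat)
    (z : 'I_d.+1 -> 'rV[int]_d)
    (v := fun i => map_mx intr (z i) : 'rV[R]_d) (x : 'rV[R]_d) j0 :
  (0 < d)%N -> (0 < l)%N -> affinely_independent v ->
  interior_lattice_points l (convex_hull v) #= `I_k ->
  interior_lattice_points l (convex_hull v) x ->
  (forall i, 1 <= bary v x i * (tail_bound l d.-1)%:R) ->
  (forall i, bary v x i <= bary v x (lift ord0 j0)) ->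
  (vol (convex_hull v) <=
    (2 ^+ (3 * d - 2) * l%:R ^+ d
      * (8 * l%:R + 7) ^+ ((d - 1) * 2 ^ (d + 1)) * k%:R / d`!%:R)%:E)%E.
Proof.
move=> d0 l0 vI Ik Ix x_deep x_max.
apply: le_trans (vol_simplex_le d0 vI) _; rewrite lee_fin.
rewrite ler_pM2r ?invr_gt0 ?ltr0n ?fact_gt0//.
have := prod_bary_le d0 l0 vI Ik Ix.
set D := `|_|%N; set U : R := (tail_bound l d.-1)%:R in x_deep *.
set b := bary v x in x_deep x_max *.
rewrite (bigD1 j0)//=; set P := \prod_(j | _) _ => DP.
have U0 : 0 < U by rewrite ltr0n tail_bound_gt0.
have b0 i : 0 < b i by rewrite -(pmulr_lgt0 _ U0) (lt_le_trans ltr01).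
have b_max : 1 <= b (lift ord0 j0) * (d + 1)%:R.
  rewrite -[leLHS](sum_bary v x) -/b; apply: le_trans (ler_sum _ (fun i _ => x_max i)) _.
  by rewrite sumr_const card_ord addn1 mulr_natr.
have P_ge : 1 <= P * U ^+ (d - 1).
  have -> : P * U ^+ (d - 1) = \prod_(j | j != j0) (b (lift ord0 j) * U).
    by rewrite big_split/= prodr_const cardC1 card_ord subn1.
  by apply: (big_ind (fun y : R => 1 <= y)) => // y1 y2; exact: mulr_ege1.
have DU : D%:R <= k%:R * l%:R ^+ d * ((d + 1)%:R * U ^+ (d - 1)).
  apply: le_trans (ler_wpM2r _ DP); last by rewrite mulr_ge0// exprn_ge0 ?ltW.
  rewrite [leRHS](_ : _ =
    D%:R * ((b (lift ord0 j0) * (d + 1)%:R) * (P * U ^+ (d - 1)))); last by ring.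
  by rewrite ler_peMr// mulr_ege1.
apply: le_trans DU _.
rewrite [leRHS](_ : _ = k%:R * l%:R ^+ d * (2 ^+ (3 * d - 2) *
  (8 * l%:R + 7) ^+ ((d - 1) * 2 ^ (d + 1)))); last by ring.
apply: ler_wpM2l; first by rewrite mulr_ge0.
apply: ler_pM => //; first by rewrite exprn_ge0 ?ltW.
  (* d + 1 <= 2 ^ d <= 2 ^ (3 d - 2), as d >= 1. *)
  rewrite -natrX ler_nat addn1; apply: leq_trans (ltn_expl d (ltnSn 1)) _.
  by rewrite leq_exp2l//; lia.
have -> : 8 * l%:R + 7 = (8 * l + 7)%:R :> R by rewrite natrD natrM.
rewrite (mulnC (d - 1)%N) exprM lerXn2r ?nnegrE ?(ltW U0) ?exprn_ge0//.
rewrite -natrX ler_nat.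
by have := tail_bound_le d.-1 l0; rewrite addn2 addn1 prednK.
Qed.

Theorem theorem6 (R : realType) (d k l : nat)
    (hd : (1 <= d)%N) (hk : (1 <= k)%N) (hl : (1 <= l)%N) :
  (forall S : set 'rV[R]_d,
     lattice_simplex S -> interior_lattice_points l S #= `I_k ->
     (vol S <= (2 ^+ (3 * d - 2)%N * l%:R ^+ d
                * (8 * l%:R + 7) ^+ ((d - 1) * 2 ^ (d + 1))%N * k%:R
                / d`!%:R)%:E)%E)
  /\
  (max_simplex_volume R d k l <=
     (2 ^+ (3 * d - 2)%N * l%:R ^+ d
      * (8 * l%:R + 7) ^+ ((d - 1) * 2 ^ (d + 1))%N * k%:R
      / d`!%:R)%:E)%E.
Proof.
set bound := (X in (_ <= X%:E)%E).
have vol_le (S : set 'rV[R]_d) : lattice_simplex S ->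
    interior_lattice_points l S #= `I_k -> (vol S <= bound%:E)%E.
  move=> [v0 [v0Z v0I ->]] Ik.
  have /boolp.choice[z hz] : forall i, exists y : 'rV[int]_d, v0 i = map_mx intr y.
    by move=> i; have [y _ <-] := v0Z i; exists y; rewrite scale1r.
  have v0E : v0 = (fun i => map_mx intr (z i)) by apply/funext.
  subst v0; set v := fun i => _ in v0I Ik *.
  have Ifin : finite_set (interior_lattice_points l (convex_hull v)) by exists k.
  have I0 : exists x, interior_lattice_points l (convex_hull v) x.
    apply/set0P/eqP => I0; move: Ik; rewrite I0 card_eq_sym card_eq0 => /eqP I00.
    have : `I_k 0%N by [].
    by rewrite I00.
  have [x Ix x_deep] := deep_interior_point hd hl v0I Ifin I0.
  case: (@arg_maxP _ _ _ ord0 xpredT (bary v x) isT) => m _ m_max.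
  have [j0 mj|m0] := unliftP ord0 m.
    apply: (vol_simplex_le_of_argmax (j0 := j0) hd hl v0I Ik Ix x_deep) => i.
    by rewrite -mj; exact: m_max.
  (* The largest coordinate sits at [v ord0]; a transposition moves it to another vertex. *)
  pose j0 := Ordinal hd; pose s := tperm ord0 (lift ord0 j0).
  have sI := affinely_independent_perm (s := s) v0I.
  have bs i : bary (v \o s) x i = bary v x (s i).
    rewrite -{1}(bary_combination x v0I) (reindex_inj (@perm_inj _ s)).
    rewrite (combination_bary (v := v \o s) (w := bary v x \o s))//.
    by rewrite -(sum_bary v x) [RHS](reindex_inj (@perm_inj _ s)).
  rewrite -(convex_hull_perm v s) in Ik Ix *.
  apply: (vol_simplex_le_of_argmax (z := z \o s) (j0 := j0) hd hl sI Ik Ix) => i.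
    by rewrite bs.
  by rewrite !bs tpermR -m0; exact: m_max.
split=> //; apply: ge_ereal_sup => _ [S [Ssimplex Sk] <-].
exact: vol_le.
Qed.
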